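(* For every integer $k \geq 2$, every finite digraph $G$ is $2/k$-majority $k$-choosable. That is, for every assignment $L: V(G) \to \mathcal{P}(\mathbb{N})$ of lists with $|L(v)| \geq k$ for all $v \in V(G)$, there is a colouring $C: V(G) \to \mathbb{N}$ with $C(v) \in L(v)$ for every $v \in V(G)$ such that for every $v \in V(G)$, at most $\frac{2}{k} d^+(v)$ out-neighbours of $v$ have colour $C(v)$.
   Context: For a vertex $v$ of a digraph $G$, $d^+(v)$ denotes its out-degree and out-neighbours are vertices $w$ with an edge $vw$ from $v$ to $w$. Colourings need not be proper. For $\eta \in [0,1]$, a colouring $C$ of $V(G)$ is an $\eta$-majority colouring if for every $v$, at most $\eta d^+(v)$ out-neighbours of $v$ have colour $C(v)$. Given lists $L: V(G) \to \mathcal{P}(\mathbb{N})$, an $L$-colouring is a colouring $C: V(G)\to\mathbb{N}$ with $C(v) \in L(v)$ for all $v$; $G$ is $\eta$-majority $k$-choosable if it has an $\eta$-majority $L$-colouring for every list assignment $L$ with all lists of size at least $k$. *)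

(* Defs.v *)
From mathcomp Require Import all_boot all_order all_algebra.
From mathcomp Require Import boolp classical_sets functions cardinality.

Set Implicit Arguments.
Unset Strict Implicit.
Unset Printing Implicit Defensive.

Import Order.TTheory GRing.Theory Num.Theory.
Local Open Scope ring_scope.
Local Open Scope card_scope.

(* A finite digraph is given by its edge relation [e] on a finite type [V] of
   vertices: there are no parallel edges, loops are excluded by the separate
   hypothesis [irreflexive e], and [e] may contain both [vw] and [wv]. *)
Section Digraph.
Variables (V : finType) (e : rel V).

Definition out_neighbours (v : V) : {set V} := [set w | e v w]%SET.

Definition outdeg (v : V) : nat := #|out_neighbours v|.

Definition majority_colouring (R : realFieldType) (eta : R) (C : V -> nat) : Prop :=
  forall v : V,
    #|[set w in out_neighbours v | C w == C v]%SET|%:R <= eta * (outdeg v)%:R.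

(* Lists are arbitrary, possibly infinite, sets of naturals. *)
Definition list_colouring (L : V -> set nat) (C : V -> nat) : Prop :=
  forall v : V, L v (C v).

(* [`I_k #<= A] says that [A] has at least [k] elements, and holds for every
   infinite [A]. *)
Definition majority_choosable (R : realFieldType) (eta : R) (k : nat) : Prop :=
  forall L : V -> set nat, (forall v : V, `I_k #<= L v) ->
    exists C : V -> nat, list_colouring L C /\ majority_colouring eta C.

End Digraph.

(* Main.v *)
Require Import Defs.
From mathcomp Require Import all_boot all_order all_algebra.
From mathcomp Require Import boolp classical_sets functions cardinality.
From mathcomp Require Import ring lra.

Set Implicit Arguments.
Unset Strict Implicit.
Unset Printing Implicit Defensive.

Import Order.TTheory GRing.Theory Num.Theory.
Local Open Scope ring_scope.

(* Let [P] be the transition matrix of the random walk on out-neighbours, and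
   give the pair [uw] the weight [pi u * P u w + pi w * P w u] for positive
   masses [pi]. In a list colouring of minimal monochromatic weight, the
   monochromatic weight at [v] is at most [1 / k] times the total weight at
   [v], that is [(pi v + (pi P) v) / k]; it is at least [pi v] times the
   fraction of out-neighbours of [v] with the colour of [v]. If [pi] were
   stationary this fraction would be at most [2 / k]. A positive stationary
   [pi] need not exist, but [pi P <= (1 + x) pi] has a positive solution for
   every [x > 0], and for [x < 1 / outdeg v] integrality removes the error. *)

Lemma bernoulli_ge (R : realFieldType) (x : R) (n : nat) :
  0 <= x -> 1 + n%:R * x <= (1 + x) ^+ n.
Proof.
move=> x0; elim: n => [|n IHn]; first by rewrite mul0r addr0 expr0.
rewrite exprS -natr1; have n0 : 0 <= n%:R :> R by exact: ler0n.
apply: le_trans (_ : (1 + x) * (1 + n%:R * x) <= _); first by nra.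
by apply: ler_wpM2l => //; lra.
Qed.

(* [pi] is a truncation of the series [\sum_i c ^+ i * (1 P^i)] with
   [c = (1 + 1 / M)^-1]. Multiplying it by [P / (1 + 1 / M)] drops the term
   [i = 0], which is [1], and adds the first neglected term, which is at
   most [1] because the mass of [1 P^i] never exceeds [#|V|]. *)
Lemma almost_stationary (R : realFieldType) (V : finType) (P : V -> V -> R)
    (M : nat) :
  (0 < M)%N -> (forall u v, 0 <= P u v) -> (forall u, \sum_v P u v <= 1) ->
  exists pi : V -> R, (forall v, 0 < pi v) /\
    (forall v, \sum_u pi u * P u v <= (1 + M%:R^-1) * pi v).
Proof.
move=> M0 P0 P1; set b : R := 1 + M%:R^-1.
have x0 : 0 < M%:R^-1 :> R by rewrite invr_gt0 ltr0n.
have b0 : 0 < b by rewrite /b; lra.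
pose f := fix f i v := if i is j.+1 then \sum_u f j u * P u v else 1 : R.
have f0 i v : 0 <= f i v.
  elim: i v => [|i IHi] v /=; first exact: ler01.
  by apply: sumr_ge0 => u _; apply: mulr_ge0.
have fsum i : \sum_v f i v <= #|V|%:R.
  elim: i => [|i IHi] /=; first by rewrite sumr_const.
  rewrite exchange_big /=; apply: le_trans IHi; apply: ler_sum => u _.
  by rewrite -mulr_sumr ler_piMr.
(* With this length [n.+1 / M = #|V| + 1 / M], so Bernoulli's inequality lifts [b ^+ n.+1] above
   [#|V|], the bound on the total mass. *)
pose n := (M * #|V|)%N.
have fn v : f n.+1 v <= b ^+ n.+1.
  apply: le_trans (_ : #|V|%:R <= _).
    apply: le_trans (fsum n.+1).
    by rewrite (bigD1 v) // lerDl sumr_ge0.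
  apply: le_trans (bernoulli_ge n.+1 (ltW x0)).
  have -> : n.+1%:R * M%:R^-1 = #|V|%:R + M%:R^-1 :> R.
    by rewrite -natr1 natrM; field; rewrite pnatr_eq0 -lt0n.
  lra.
exists (fun v => \sum_(i < n.+1) b ^- i * f i v); split=> v.
  rewrite big_ord_recl /= expr0 invr1 mul1r ltr_pwDl // sumr_ge0 // => i _.
  by apply: mulr_ge0 (f0 (lift ord0 i) v); rewrite invr_ge0 exprn_ge0 // ltW.
have -> : \sum_u (\sum_(i < n.+1) b ^- i * f i u) * P u v =
          \sum_(i < n.+1) b * (b ^- i.+1 * f i.+1 v).
  under eq_bigr do rewrite mulr_suml.
  rewrite exchange_big /=; apply: eq_bigr => i _.
  rewrite exprS invfM !mulrA divff ?mul1r ?gt_eqF // mulr_sumr.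
  by apply: eq_bigr => u _; rewrite mulrA.
rewrite -mulr_sumr ler_pM2l // big_ord_recr [leRHS]big_ord_recl /= addrC.
apply: lerD => //; rewrite expr0 invr1 mul1r.
by rewrite mulrC ler_pdivrMr ?exprn_gt0 // mul1r; exact: fn.
Qed.

(** Separates the pairs that contain [v], the only ones affected by recolouring [v]; by symmetry its
    row and column agree, hence the factor 2. *)
Lemma sum_symm_split (R : realFieldType) (V : finType) (F : V -> V -> R) v :
  (forall u w, F u w = F w u) -> F v v = 0 ->
  \sum_u \sum_w F u w =
    2 * (\sum_(u | u != v) F u v) + \sum_(u | u != v) \sum_(w | w != v) F u w.
Proof.
move=> Fsym Fv; rewrite (bigD1 v) //= (bigD1 v) //= Fv add0r.
under [X in _ + X]eq_bigr => u _ do rewrite (bigD1 v) //=.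
rewrite big_split /= addrA mulrDl !mul1r; congr (_ + _ + _).
by apply: eq_bigr => u _; rewrite Fsym.
Qed.

(* A list colouring minimising the total weight of monochromatic pairs: the
   average over the [k] recolourings of [v] bounds the weight at [v]. *)
Lemma local_min_colouring (R : realFieldType) (V : finType) (T : eqType)
    (s : V -> V -> R) (k : nat) (g : V -> 'I_k -> T) :
  (0 < k)%N -> (forall v, injective (g v)) ->
  (forall u w, 0 <= s u w) -> (forall u w, s u w = s w u) ->
  (forall u, s u u = 0) ->
  exists C : {ffun V -> 'I_k}, forall v,
    k%:R * (\sum_(u | g u (C u) == g v (C v)) s u v) <= \sum_u s u v.
Proof.
move=> k0 ginj s0 ssym sd.
pose F (C : {ffun V -> 'I_k}) u w := s u w * (g u (C u) == g w (C w))%:R.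
have Fsym C u w : F C u w = F C w u by rewrite /F ssym eq_sym.
have Fd C u : F C u u = 0 by rewrite /F sd mul0r.
pose C0 : {ffun V -> 'I_k} := [ffun=> Ordinal k0].
case: (@Order.TotalTheory.arg_minP _ R _ C0 xpredT (fun C => \sum_u \sum_w F C u w)) => // C _ Cmin.
exists C => v.
have step j : \sum_(u | g u (C u) == g v (C v)) s u v <=
              \sum_u s u v * (g u (C u) == g v j)%:R.
  pose D : {ffun V -> 'I_k} := [ffun u => if u == v then j else C u].
  have := Cmin D isT.
  rewrite !(@sum_symm_split _ _ _ v) //.
  have -> : \sum_(u | u != v) \sum_(w | w != v) F D u w =
            \sum_(u | u != v) \sum_(w | w != v) F C u w.
    apply: eq_bigr => u uv; apply: eq_bigr => w wv.
    by rewrite /F !ffunE (negbTE uv) (negbTE wv).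
  rewrite lerD2r ler_pM2l // => le_CD.
  apply: le_trans (_ : \sum_(u | u != v) F D u v <= _).
    apply: le_trans le_CD; rewrite big_mkcond (bigD1 v) //= eqxx sd add0r.
    by apply: ler_sum => u _; rewrite /F mulr_natr mulrb.
  rewrite [leRHS](bigD1 v) //= sd mul0r add0r; apply: ler_sum => u uv.
  by rewrite /F !ffunE eqxx (negbTE uv).
have -> : k%:R * (\sum_(u | g u (C u) == g v (C v)) s u v) =
          \sum_(j < k) \sum_(u | g u (C u) == g v (C v)) s u v.
  by rewrite sumr_const card_ord mulr_natl.
apply: le_trans (ler_sum _ (fun j _ => step j)) _.
rewrite exchange_big /=; apply: ler_sum => u _.
(* As [g v] is injective, at most one of the [k] recolourings gives [v] the colour of [u]. *)
rewrite -mulr_sumr ler_piMr // -natr_sum lern1.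
case: (pickP (fun j => g u (C u) == g v j)) => [j0 /eqP ej0|no_j]; last first.
  by rewrite big1 // => j _; rewrite no_j.
rewrite (bigD1 j0) //= big1 ?addn0 ?leq_b1 // => j jj0.
by rewrite ej0 (inj_eq (ginj v)) eq_sym (negbTE jj0).
Qed.

Theorem theorem1 (R : realFieldType) (k : nat) (hk : (2 <= k)%N)
    (V : finType) (e : rel V) (he : irreflexive e) :
  majority_choosable e (2 / k%:R : R) k.
Proof.
move=> L Lk; have k0 : (0 < k)%N by exact: leq_trans hk.
have /choice[g gL] : forall v, exists h : nat -> nat,
    (forall i, (i < k)%N -> L v (h i)) /\
    (forall i j, (i < k)%N -> (j < k)%N -> h i = h j -> i = j).
  move=> v.
  have /pcard_leP/injfunPex[h hL hinj] := Lk v.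
  exists h; split=> [i ik|i j ik jk]; first exact: hL.
  by apply: hinj; rewrite inE.
(* The row of a vertex without out-neighbours is zero, so [P] is only substochastic. *)
pose P u w : R := (e u w)%:R / (outdeg e u)%:R.
have Pge0 u w : 0 <= P u w by rewrite divr_ge0.
have degE u : \sum_w (e u w)%:R = (outdeg e u)%:R :> R.
  rewrite -natr_sum -big_mkcond /= sum1_card; congr _%:R.
  by apply: eq_card => w; rewrite inE.
have Psum u : \sum_w P u w <= 1.
  rewrite -mulr_suml degE; have [->|d0] := eqVneq (outdeg e u) 0%N.
    by rewrite mul0r ler01.
  by rewrite divff // pnatr_eq0.
(* [M = #|V|.+1] exceeds every out-degree [d], which keeps the final error [d / M] below 1. *)
have [pi [pi0 piP]] := almost_stationary (ltn0Sn #|V|) Pge0 Psum.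
pose s u w := pi u * P u w + pi w * P w u.
have [|||||C HC] := @local_min_colouring R V nat s k (fun v i => g v i).
- by [].
- by move=> v i j /(proj2 (gL v) _ _ (ltn_ord i) (ltn_ord j))/val_inj.
- by move=> u w; apply: addr_ge0; apply: mulr_ge0; rewrite ?Pge0 ?ltW.
- by move=> u w; rewrite /s addrC.
- by move=> u; rewrite /s /P he mul0r mulr0 addr0.
exists (fun v => g v (C v)); split=> v; first exact: (proj1 (gL v)).
set A := [set w in _ | _]%SET; set d := outdeg e v.
have d_le : (d <= #|V|)%N by exact: max_card.
have A_le : (#|A| <= d)%N.
  by apply: subset_leq_card; apply/fintype.subsetP => w; rewrite inE => /andP[].
have [d0|d0] := posnP d.
  by move: A_le; rewrite d0 leqn0 => /eqP ->; rewrite mulr0.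
have dR : 0 < d%:R :> R by rewrite ltr0n.
have sum_s : \sum_u s u v <= (2 + #|V|.+1%:R^-1) * pi v.
  rewrite big_split /= -mulr_sumr.
  apply: le_trans (lerD (piP v) (ler_wpM2l (ltW (pi0 v)) (Psum v))) _.
  by rewrite -[2]/(1 + 1) mulr1 addrAC [leRHS]mulrDl mul1r.
(* Only edges leaving [v] are kept: the summand [pi u * P u v] of [s u v] is dropped. *)
have A_s : pi v * (#|A|%:R / d%:R) <=
           \sum_(u | g u (C u) == g v (C v)) s u v.
  have -> : #|A|%:R = \sum_(u | g u (C u) == g v (C v)) (e v u)%:R :> R.
    rewrite -natr_sum -sum1_card big_mkcond [in RHS]big_mkcond /=.
    by congr _%:R; apply: eq_bigr => u _; rewrite !inE; case: (e v u); case: eqP.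
  rewrite mulr_suml mulr_sumr; apply: ler_sum => u _.
  by rewrite /s lerDr; apply: mulr_ge0; rewrite ?Pge0 ?ltW.
have kA : k%:R * #|A|%:R <= (2 + #|V|.+1%:R^-1) * d%:R :> R.
  rewrite -ler_pdivrMr // -(ler_pM2r (pi0 v)); apply: le_trans sum_s.
  apply: le_trans (HC v); apply: le_trans (ler_wpM2l (ler0n R k) A_s).
  by rewrite le_eqVlt; apply/orP; left; apply/eqP; ring.
have d_lt : #|V|.+1%:R^-1 * d%:R < 1 :> R.
  by rewrite mulrC ltr_pdivrMr ?ltr0n // mul1r ltr_nat ltnS.
rewrite mulrAC ler_pdivlMr ?ltr0n // mulrC -!natrM ler_nat.
(* Between integers, [k * #|A| < 2 * d + 1] suffices. *)
rewrite -ltnS -(ltr_nat R) -natr1 !natrM (le_lt_trans kA) //.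
by rewrite mulrDl ltrD2l.
Qed.
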